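(* Let $c_1,c_2,f,F:\mathbb{N}_+\to\mathbb{R}_+$ be functions such that, for some $N_0\in\mathbb{N}_+$, the inequalities $$c_1(n)e^{f(n)}<F(n)<c_2(n)e^{f(n)}$$ hold for all positive integers $n\geq N_0$. Suppose further that: (1) there exist a function $g:\mathbb{N}_+\to\mathbb{R}_+$ and $N_1\in\mathbb{N}_+$ such that for all integers $a\geq b\geq N_1$ we have $f(a)+f(b)-f(a+b)\geq g(b)$; (2) there exist a function $h:\mathbb{N}_+\to\mathbb{R}_+$ and $N_2\in\mathbb{N}_+$ such that for all integers $a\geq b\geq N_2$ we have $c_2(a+b)/c_1(a)\leq h(b)$; (3) there exists $N_3\in\mathbb{N}_+$ such that for all $n\geq N_3$ we have $g(n)\geq \log h(n)-\log c_1(n)$. Then $F(a)F(b)>F(a+b)$ for all integers $a,b\geq\max\{N_0,N_1,N_2,N_3\}$.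
   Context: $\mathbb{N}_+$ denotes the set of positive integers and $\mathbb{R}_+=(0,+\infty)$. *)

(* Defs.v *)
From Stdlib Require Export Reals PArith.

(* Main.v *)
Require Import Defs.
From Stdlib Require Import Reals PArith Lra Lia.
Open Scope R_scope.

(* The chain behind the theorem, for [b <= a], is
   [F (a + b) < c2 (a + b) e^(f (a + b)) <= h b c1(a) e^(f (a + b))
    <= c1(a) c1(b) e^(g b + f (a + b)) <= c1(a) c1(b) e^(f a + f b) < F a F b];
   the case [a <= b] follows since the conclusion is symmetric in [a] and [b]. *)

(** Writing [x] and [y] as exponentials of their logarithms reduces this to monotonicity of [exp].
    It puts the logarithmic condition on [h] and [c1] into multiplicative form. *)
Lemma le_mul_exp_of_ln_sub_le (x y t : R) :
  0 < x -> 0 < y -> ln x - ln y <= t -> x <= y * exp t.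
Proof.
  intros Hx Hy Ht.
  rewrite <- (exp_ln x Hx), <- (exp_ln y Hy) at 1.
  rewrite <- exp_plus.
  (* [exp_increasing] is strict, so equal exponents are a separate case. *)
  destruct (Rle_lt_or_eq_dec (ln x) (ln y + t)) as [Hlt | Heq]; [lra | |].
  - now apply Rlt_le, exp_increasing.
  - now rewrite Heq; right.
Qed.

(** The non-strict middle of the chain, with [u], [v], [w] standing for [f a], [f b],
    [f (a + b)]. *)
Lemma upper_bound_le_prod_lower_bounds (ca cb c2 h g u v w : R) :
  0 < ca -> 0 < cb -> 0 < h ->
  c2 / ca <= h -> ln h - ln cb <= g -> g <= u + v - w ->
  c2 * exp w <= (ca * exp u) * (cb * exp v).
Proof.
  intros Hca Hcb Hh Hc2 Hg Huvw.
  assert (Hc2h : c2 <= h * ca).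
  { replace c2 with (c2 / ca * ca) by (field; lra).
    apply Rmult_le_compat_r; lra. }
  (* Passing through [g] gives the exponent [u + v - w], whose [- w] cancels against the factor
     [exp w]. *)
  assert (Hhc : h <= cb * exp (u + v - w))
    by (apply le_mul_exp_of_ln_sub_le; lra).
  apply Rle_trans with (cb * exp (u + v - w) * ca * exp w).
  - apply Rmult_le_compat_r; [apply Rlt_le, exp_pos |].
    apply Rle_trans with (1 := Hc2h).
    apply Rmult_le_compat_r; lra.
  - right.
    replace (ca * exp u * (cb * exp v)) with (cb * ca * exp (u + v))
      by (rewrite exp_plus; ring).
    (* The first occurrence of [u + v] lies inside [u + v - w]; the second is the exponent on the
       right. *)
    replace (u + v) with ((u + v - w) + w) at 2 by ring.
    rewrite (exp_plus (u + v - w)); ring.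
Qed.

Theorem theorem2p1
  (c1 c2 f F : positive -> posreal) (N0 : positive)
  (hF : forall n : positive, (N0 <= n)%positive ->
     c1 n * exp (f n) < F n < c2 n * exp (f n))
  (g : positive -> posreal) (N1 : positive)
  (hg : forall a b : positive, (N1 <= b)%positive -> (b <= a)%positive ->
     f a + f b - f (a + b)%positive >= g b)
  (h : positive -> posreal) (N2 : positive)
  (hh : forall a b : positive, (N2 <= b)%positive -> (b <= a)%positive ->
     c2 (a + b)%positive / c1 a <= h b)
  (N3 : positive)
  (hgh : forall n : positive, (N3 <= n)%positive ->
     g n >= ln (h n) - ln (c1 n)) :
  forall a b : positive,
    (Pos.max (Pos.max N0 N1) (Pos.max N2 N3) <= a)%positive ->
    (Pos.max (Pos.max N0 N1) (Pos.max N2 N3) <= b)%positive ->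
    F a * F b > F (a + b)%positive.
Proof.
  (* Bounding the smaller index [b] suffices: [a] and [a + b] then exceed the thresholds too. *)
  assert (Hle : forall a b : positive,
    (Pos.max (Pos.max N0 N1) (Pos.max N2 N3) <= b)%positive ->
    (b <= a)%positive -> F (a + b)%positive < F a * F b).
  { intros a b Hb Hba.
    assert (Hlow : forall n, 0 < c1 n * exp (f n))
      by (intro n; apply Rmult_lt_0_compat; [apply cond_pos | apply exp_pos]).
    destruct (hF a ltac:(lia)) as [HFa _].
    destruct (hF b ltac:(lia)) as [HFb _].
    destruct (hF (a + b)%positive ltac:(lia)) as [_ HFab].
    apply Rlt_trans with (1 := HFab).
    apply Rle_lt_trans with ((c1 a * exp (f a)) * (c1 b * exp (f b))).
    - apply upper_bound_le_prod_lower_bounds with (h := h b) (g := g b);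
        try apply cond_pos.
      + apply hh; lia.
      + apply Rge_le, hgh; lia.
      + apply Rge_le, hg; lia.
    (* Multiplying the two strict lower bounds is sound because both are positive. *)
    - apply Rmult_le_0_lt_compat; auto; apply Rlt_le, Hlow. }
  intros a b Ha Hb; apply Rlt_gt.
  assert ((b <= a)%positive \/ (a <= b)%positive) as [Hba | Hab] by lia.
  - now apply Hle.
  - rewrite Pos.add_comm, Rmult_comm; now apply Hle.
Qed.
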